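(* Let $S_2=\{y\in[0,\tfrac23]:|L(y)|=2\}$. The set $S_2$ is nowhere dense and $G_\delta$. It is not closed. Its Lebesgue measure $\lambda(S_2)$ satisfies $$\frac{5}{12}<\lambda(S_2)<\frac{35}{72}.$$
   Context: Let $\phi(x)=\operatorname{dist}(x,\mathbb{Z})$; the Takagi function is $T(x)=\sum_{n=0}^\infty 2^{-n}\phi(2^nx)$, and $L(y)=\{x\in[0,1]:T(x)=y\}$. $|\cdot|$ denotes cardinality. *)

(* Defs.v *)
From HB Require Import structures.
From mathcomp Require Import all_boot all_order all_algebra.
From mathcomp Require Import all_classical all_reals all_analysis.
From mathcomp Require Import borel_hierarchy.

Set Implicit Arguments.
Unset Strict Implicit.
Unset Printing Implicit Defensive.

Import Order.TTheory GRing.Theory Num.Theory.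
Import numFieldNormedType.Exports.

Local Open Scope classical_set_scope.
Local Open Scope card_scope.
Local Open Scope ring_scope.

Definition dist_int (R : realType) (x : R) : R :=
  inf [set `|x - k%:~R| | k in [set: int]].

Definition takagi (R : realType) (x : R) : R :=
  limn (series (fun n : nat => 2 ^- n * dist_int (2 ^+ n * x))).

Definition takagi_level (R : realType) (y : R) : set R :=
  [set x : R | x \in `[0, 1] /\ takagi x = y].

Definition S2 (R : realType) : set R :=
  [set y : R | y \in `[0, 2 / 3] /\ takagi_level y #= `I_2].
Arguments S2 : clear implicits.

Definition nowhere_dense (T : topologicalType) (A : set T) : Prop :=
  interior (closure A) = set0.

(* Main.v *)
Require Import Defs.
From mathcomp Require Import all_boot all_order all_algebra.
From mathcomp Require Import all_classical all_reals all_analysis.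
From mathcomp Require Import borel_hierarchy measurable_realfun.
From mathcomp Require Import ring lra.

(** Write [F_k(x) = T(x) + k x].  On the two halves of [0, 1] the graph of [F_k]
    is a half-scale copy of the graphs of [F_(k+1)] and [F_(k-1)], and the maximum
    of [F_k] on [0, 1] is [k + e_k] with [e_k = (2/3) 2^-k].  For [0 <= w < k] the
    equation [F_k(x) = w] therefore has solutions in both halves exactly when
    [k + 1 <= 2 w <= k + 1 + e_(k+1)], and otherwise passes to
    [F_(k+1) = 2 w] or [F_(k-1) = 2 w - (k + 1)].  Hence [S_2] is [0, 1/2) minus
    countably many closed intervals, met by the orbits of this renormalization.
    Such intervals occur in every neighbourhood of every point of [0, 1/2), so
    [S_2] is nowhere dense; the renormalization permutes the right endpoints
    [w = k], so pulling a point of [S_2] back along it gives points of [S_2] that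
    tend to 1/2, a value attained at 1/4, 1/2 and 3/4.  The lengths of the intervals sum to 1/12,
    but some of them overlap, whence the strict lower bound 1/2 - 1/12; three
    explicit disjoint ones have total length 1/64 > 1/72, whence the upper bound. *)

Import Order.TTheory GRing.Theory Num.Theory.
Import numFieldNormedType.Exports.

Local Open Scope classical_set_scope.
Local Open Scope ring_scope.

Set Implicit Arguments.
Unset Strict Implicit.

(** * Distance to the nearest integer *)

Lemma dist_int_le (R : realType) (x : R) (k : int) :
  dist_int x <= `|x - k%:~R|.
Proof.
apply: ge_inf; last by exists k.
by exists 0 => _ [j _ <-].
Qed.

Lemma dist_int_ge (R : realType) (x c : R) :
  (forall k : int, c <= `|x - k%:~R|) -> c <= dist_int x.
Proof.
move=> h; apply: lb_le_inf; first by exists `|x - 0%:~R|, 0.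
by move=> _ [j _ <-].
Qed.

Lemma dist_int_ge0 (R : realType) (x : R) : 0 <= dist_int x.
Proof. exact: dist_int_ge. Qed.

Lemma dist_intD (R : realType) (x : R) (m : int) :
  dist_int (x + m%:~R) = dist_int x.
Proof.
apply/eqP; rewrite eq_le; apply/andP; split; apply: dist_int_ge => k.
  apply: le_trans (dist_int_le _ (k + m)) _.
  by rewrite intrD opprD addrACA subrr addr0.
apply: le_trans (dist_int_le _ (k - m)) _.
by rewrite intrB opprB addrA [x + _ + _]addrAC addrAC.
Qed.

Lemma dist_intN (R : realType) (x : R) : dist_int (- x) = dist_int x.
Proof.
apply/eqP; rewrite eq_le; apply/andP; split; apply: dist_int_ge => k;
  apply: le_trans (dist_int_le _ (- k)) _; rewrite intrN opprK.
  by rewrite addrC distrC.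
by rewrite -normrN opprD.
Qed.

Lemma dist_int_id (R : realType) (x : R) : 0 <= x <= 1 / 2 -> dist_int x = x.
Proof.
move=> /andP[x0 x1]; apply/eqP; rewrite eq_le; apply/andP; split.
  by apply: le_trans (dist_int_le _ 0) _; rewrite subr0 ger0_norm.
apply: dist_int_ge => k; have [k0|k0] := leP k 0.
  have : k%:~R <= 0 :> R by rewrite lerz0.
  by move=> ?; apply: le_trans (ler_norm _); lra.
have : 1 <= k%:~R :> R by rewrite ler1z.
by move=> ?; rewrite distrC; apply: le_trans (ler_norm _); lra.
Qed.

Lemma dist_int_lipschitz (R : realType) (x y : R) :
  `|dist_int x - dist_int y| <= `|x - y|.
Proof.
have h (a b : R) : dist_int a - dist_int b <= `|a - b|.
  rewrite lerBlDl -lerBlDr; apply: dist_int_ge => k; rewrite lerBlDr.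
  apply: le_trans (dist_int_le _ k) _.
  by rewrite (_ : a - k%:~R = (b - k%:~R) + (a - b)) ?ler_normD//; ring.
by rewrite ler_norml lerNl opprB h andbT distrC h.
Qed.

(** If t is the fractional part of x, the first distance is at most t and at most 1 - t, the second
    at most |2t - 1|, and t + (1 - 2t)/2 = 1/2. Coupling two consecutive terms of the series in this
    way is what brings the bound on T down to 2/3. *)
Lemma dist_int_split (R : realType) (x : R) :
  dist_int x + dist_int (2 * x) / 2 <= 1 / 2.
Proof.
set j := Num.floor x; have ex : x = (x - j%:~R) + j%:~R by rewrite subrK.
have : 0 <= x - j%:~R < 1.
  by rewrite subr_ge0 floor_le ltrBlDl -intrD1 floorD1_gt.
move: (x - _) ex => t ex /andP[t0 t1]; rewrite ex.
have -> : 2 * (t + j%:~R) = 2 * t + (2 * j)%:~R by rewrite intrM mulrDr.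
rewrite !dist_intD.
have := dist_int_le t 0; have := dist_int_le t 1.
have := dist_int_le (2 * t) 1; rewrite subr0 (ger0_norm t0) (@ler0_norm _ (t - 1)); last lra.
by have [h|h] := leP 0 (2 * t - 1); rewrite ?(ger0_norm h) ?(ltr0_norm h); lra.
Qed.

Lemma dist_int_le_half (R : realType) (x : R) : dist_int x <= 1 / 2.
Proof. by have := dist_int_split x; have := dist_int_ge0 (2 * x); lra. Qed.

(** * Geometric error terms *)

(** Removes the error term from estimates proved by induction on [n]: [z] is 1/4 in [takagi_le] and
    1/2 in [not_multiple_unique]. *)
Lemma le_geometric (R : realType) (a b c z : R) : `|z| < 1 ->
  (forall n : nat, a <= b + c * z ^+ n) -> a <= b.
Proof.
move=> z1 h.
have cv : b + c * z ^+ n @[n --> \oo] --> b + c * 0.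
  by apply: cvgD; [exact: cvg_cst|apply: cvgM; [exact: cvg_cst|exact: cvg_expr]].
rewrite mulr0 addr0 in cv; rewrite -(cvg_lim (@Rhausdorff R) cv).
apply: limr_ge; first by apply/cvg_ex; exists b.
by apply: nearW.
Qed.

Lemma expr_le_exists (R : realType) (z e : R) : `|z| < 1 -> 0 < e ->
  exists n : nat, z ^+ n <= e.
Proof.
move=> z1 e0; have [[n hn]|h] := pselect (exists n : nat, z ^+ n <= e); first by exists n.
suff : e <= 0 by lra.
apply: (@le_geometric _ e 0 1 z) => // n; rewrite add0r mul1r leNgt.
by apply/negP => zn; apply: h; exists n; exact: ltW.
Qed.

(** * The Takagi function: bounds, functional equations, continuity *)

Lemma takagi_partial_bounds (R : realType) (x : R) (n : nat) :
  0 <= series (fun n : nat => 2 ^- n * dist_int (2 ^+ n * x)) n <= 1 - 2 ^- n.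
Proof.
elim: n => [|n]; first by rewrite /series /= big_geq// expr0 invr1 subrr lexx.
rewrite seriesSr => /andP[h0 h1].
have p : 0 < 2 ^- n :> R by rewrite invr_gt0 exprn_gt0.
have := mulr_ge0 (ltW p) (dist_int_ge0 (2 ^+ n * x)).
have := ler_wpM2l (ltW p) (dist_int_le_half (2 ^+ n * x)).
by rewrite exprS invfM; move=> *; apply/andP; split; lra.
Qed.

Lemma is_cvg_takagi (R : realType) (x : R) :
  cvgn (series (fun n : nat => 2 ^- n * dist_int (2 ^+ n * x))).
Proof.
apply: nondecreasing_is_cvgn.
  apply/nondecreasing_seqP => n; rewrite seriesSr lerDl mulr_ge0 ?dist_int_ge0//.
exists 1 => _ [n _ <-]; have /andP[_ /le_trans] := takagi_partial_bounds x n.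
by apply; rewrite lerBlDr lerDl invr_ge0 exprn_ge0.
Qed.

Lemma takagi_ge0 (R : realType) (x : R) : 0 <= takagi x.
Proof.
apply: limr_ge; first exact: is_cvg_takagi.
by apply: nearW => n; case/andP: (takagi_partial_bounds x n).
Qed.

Lemma takagi_step (R : realType) (x : R) :
  takagi x = dist_int x + takagi (2 * x) / 2.
Proof.
apply: (cvg_lim (@Rhausdorff R)).
rewrite -cvg_shiftS /=.
rewrite (_ : (fun n => _) = fun n => dist_int x +
  series (fun n : nat => 2 ^- n * dist_int (2 ^+ n * (2 * x))) n / 2).
  apply: cvgD; first exact: cvg_cst.
  by apply: cvgM; [exact: is_cvg_takagi|exact: cvg_cst].
apply/funext => n; rewrite /series /= big_nat_recl//=.
rewrite expr0 invr1 !mul1r; congr (_ + _); rewrite mulr_suml.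
apply: eq_bigr => i _; rewrite exprS invfM.
by rewrite [2 * 2 ^+ i]mulrC -[2 ^+ i * 2 * x]mulrA; ring.
Qed.

(** Two uses of the functional equation give T(x) <= 1/2 + T(4x)/4, a contraction with fixed point
    2/3. The induction starts from the crude bound 1 = 2/3 + 1/3, and the excess shrinks by 1/4 each
    time. *)
Lemma takagi_le (R : realType) (x : R) : takagi x <= 2 / 3.
Proof.
have h n (y : R) : takagi y <= 2 / 3 + 1 / 3 * (1 / 4) ^+ n.
  elim: n y => [|n ih] y.
    rewrite expr0; apply: limr_le; first exact: is_cvg_takagi.
    apply: nearW => n; have /andP[_ h1] := takagi_partial_bounds y n.
    have : 0 < 2 ^- n :> R by rewrite invr_gt0 exprn_gt0.
    lra.
  rewrite exprS (takagi_step y) (takagi_step (2 * y)).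
  have := dist_int_split y; have := ih (2 * (2 * y)).
  by move: ((1 / 4) ^+ n) => z; lra.
apply: (@le_geometric _ _ _ (1 / 3) (1 / 4)); first by rewrite ger0_norm; lra.
by move=> n; exact: h.
Qed.

Lemma takagiD (R : realType) (x : R) (m : int) : takagi (x + m%:~R) = takagi x.
Proof.
congr (limn (series _)); apply/funext => n; congr (_ * _).
by rewrite (_ : _ * (_ + _) = 2 ^+ n * x + (2 ^+ n * m)%:~R) ?dist_intD// intrM rmorphXn mulrDr.
Qed.

Lemma takagi_sym (R : realType) (x : R) : takagi (1 - x) = takagi x.
Proof.
rewrite -(takagiD _ (-1)) intrN addrAC subrr add0r.
by congr (limn (series _)); apply/funext => n; rewrite [_ ^+ n * _]mulrN dist_intN.
Qed.

Lemma takagi_left (R : realType) (x : R) : 0 <= x <= 1 / 2 ->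
  takagi x = x + takagi (2 * x) / 2.
Proof. by move=> h; rewrite takagi_step dist_int_id. Qed.

Lemma takagi_right (R : realType) (x : R) : 1 / 2 <= x <= 1 ->
  takagi x = 1 - x + takagi (2 * x - 1) / 2.
Proof.
move=> /andP[h0 h1]; rewrite -takagi_sym takagi_left; last by apply/andP; split; lra.
by rewrite -(takagi_sym (2 * _)); congr (_ + takagi _ / 2); lra.
Qed.

(** T is not Lipschitz, but n uses of the functional equation give the modulus n|x - y| + 2^-n: each
    use adds one |x - y| from the distance term, while the doubling of the argument is cancelled by
    the factor 1/2. *)
Lemma takagi_continuous (R : realType) : continuous (@takagi R).
Proof.
have mod n (x y : R) : `|takagi x - takagi y| <= n%:R * `|x - y| + 2 ^- n.
  elim: n x y => [|n ih] x y.
    rewrite mul0r add0r expr0 invr1 ler_norml.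
    have := takagi_ge0 x; have := takagi_ge0 y.
    by have := takagi_le x; have := takagi_le y; move=> *; apply/andP; split; lra.
  rewrite (takagi_step x) (takagi_step y).
  have -> : forall a b c d : R, a + c / 2 - (b + d / 2) = (a - b) + (c - d) / 2.
    by move=> *; lra.
  apply: le_trans (ler_normD _ _) _; rewrite normrM.
  have := ih (2 * x) (2 * y); rewrite -mulrBr normrM.
  rewrite (ger0_norm (_ : 0 <= 2 :> R)) // (ger0_norm (_ : 0 <= 2^-1 :> R)); last lra.
  have := dist_int_lipschitz x y; rewrite exprS invfM -[n.+1%:R]natr1.
  move: `|x - y| `|dist_int x - dist_int y| `|takagi _ - takagi _| (2 ^- n) => a b c d.
  rewrite (_ : n%:R * (2 * a) = 2 * (n%:R * a)); last ring.
  by rewrite [(n%:R + 1) * a]mulrDl mul1r; move: (n%:R * a) => e; lra.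
move=> x; apply/cvgrPdist_le => e e0.
have [n hn] : exists n, (1 / 2) ^+ n <= e / 2.
  by apply: expr_le_exists; [rewrite ger0_norm; lra|lra].
rewrite div1r exprVn in hn.
have d0 : 0 < e / 2 / n.+1%:R by rewrite divr_gt0//; lra.
have : \forall y \near x, `|x - y| <= e / 2 / n.+1%:R.
  have /cvgrPdist_le := @cvg_id R (nbhs x). exact.
apply: filterS => y hy; apply: le_trans (mod n.+1 x y) _.
have : n.+1%:R * `|x - y| <= e / 2.
  by rewrite mulrC -ler_pdivlMr.
have : 2 ^- n.+1 <= 2 ^- n :> R.
  by rewrite exprS invfM ger_pMl ?invr_gt0 ?exprn_gt0//; lra.
lra.
Qed.

(** * Sloped Takagi functions and their range *)

(** The maximum of [takagi x - k * x] over [0, 1]. *)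
Definition peak (R : realType) (k : nat) : R := 2 / 3 * 2 ^- k.

Definition sloped (R : realType) (k : nat) (x : R) : R := takagi x + k%:R * x.

Lemma peakS (R : realType) (k : nat) : peak R k.+1 = peak R k / 2.
Proof. by rewrite /peak exprS invfM; ring. Qed.

Lemma peak_gt0 (R : realType) (k : nat) : 0 < peak R k.
Proof. by rewrite mulr_gt0 ?invr_gt0 ?exprn_gt0//; lra. Qed.

Lemma peak_le (R : realType) (k : nat) : peak R k <= 2 / 3.
Proof.
elim: k => [|k ih]; first by rewrite /peak expr0; lra.
by rewrite peakS; have := peak_gt0 R k; lra.
Qed.

Lemma sloped_left (R : realType) (k : nat) (u : R) : 0 <= u <= 1 / 2 ->
  sloped k u = sloped k.+1 (2 * u) / 2.
Proof. by move=> h; rewrite /sloped takagi_left// -[k.+1%:R]natr1; field. Qed.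

Lemma sloped_right (R : realType) (k : nat) (u : R) : 1 / 2 <= u <= 1 ->
  sloped k.+1 u = (k.+2%:R + sloped k (2 * u - 1)) / 2.
Proof.
by move=> h; rewrite /sloped takagi_right// -[k.+2%:R]natr1 -[k.+1%:R]natr1; field.
Qed.

Lemma takagi0 (R : realType) : takagi (0 : R) = 0.
Proof. by have := @takagi_left R 0; rewrite mulr0 lexx => /(_ _); lra. Qed.

Lemma takagi_third (R : realType) : takagi (1 / 3 : R) = 2 / 3.
Proof.
have : takagi (1 / 3 : R) = 1 / 3 + takagi (2 * (1 / 3)) / 2.
  by apply: takagi_left; apply/andP; split; lra.
rewrite -(takagi_sym (2 * _)) (_ : 1 - 2 * (1 / 3) = 1 / 3 :> R); last lra.
by move=> ?; lra.
Qed.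

Lemma takagi_sub_le_peak (R : realType) (k : nat) (s : R) : 0 <= s <= 1 ->
  takagi s - k%:R * s <= peak R k.
Proof.
elim: k s => [|k ih] s /andP[s0 s1].
  by rewrite mul0r subr0 /peak expr0 invr1 mulr1 takagi_le.
have half t : 0 <= t <= 1 / 2 -> takagi t - k.+1%:R * t <= peak R k.+1.
  move=> /andP[t0 t1]; rewrite takagi_left ?t0// peakS.
  have /ih : 0 <= 2 * t <= 1 by apply/andP; split; lra.
  rewrite -[k.+1%:R]natr1 [(k%:R + 1) * t]mulrDl.
  by rewrite (_ : k%:R * (2 * t) = 2 * (k%:R * t)); [lra|ring].
have [h|h] := leP s (1 / 2); first by apply: half; rewrite s0.
apply: le_trans (half (1 - s) _); last by apply/andP; split; lra.
by rewrite takagi_sym lerD2l lerN2 ler_wpM2l//; lra.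
Qed.

Lemma takagi_sub_eq_peak (R : realType) (k : nat) :
  exists2 s : R, 0 < s <= 1 & takagi s - k%:R * s = peak R k.
Proof.
elim: k => [|k [s /andP[s0 s1] e]].
  exists (1 / 3); first by apply/andP; split; lra.
  by rewrite takagi_third mul0r subr0 /peak expr0 invr1 mulr1.
exists (s / 2); first by apply/andP; split; lra.
rewrite takagi_left; last by apply/andP; split; lra.
rewrite (_ : 2 * (s / 2) = s); last by field.
by rewrite peakS -e -[k.+1%:R]natr1; field.
Qed.

Lemma sloped_ge0 (R : realType) (k : nat) (v : R) : 0 <= v -> 0 <= sloped k v.
Proof. by move=> v0; rewrite addr_ge0 ?takagi_ge0 ?mulr_ge0. Qed.

Lemma sloped_le (R : realType) (k : nat) (v : R) : 0 <= v <= 1 ->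
  sloped k v <= k%:R + peak R k.
Proof.
move=> /andP[v0 v1]; have : 0 <= 1 - v <= 1 by apply/andP; split; lra.
by move=> /(takagi_sub_le_peak k); rewrite takagi_sym /sloped mulrBr mulr1; lra.
Qed.

(** If s maximizes T(x) - kx, then by symmetry 1 - s maximizes [sloped k], so the intermediate value
    theorem applies on [0, 1 - s]. Since s > 0, the solution is below 1; half-open intervals keep
    preimages from the two halves distinct. *)
Lemma sloped_surj (R : realType) (k : nat) (w : R) :
  0 <= w <= k%:R + peak R k -> exists2 v, 0 <= v < 1 & sloped k v = w.
Proof.
move=> /andP[w0 w1]; have [s /andP[s0 s1] es] := takagi_sub_eq_peak R k.
have h0 : sloped k (0 : R) = 0 by rewrite /sloped takagi0 mulr0 addr0.
have h1 : sloped k (1 - s) = k%:R + peak R k.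
  by rewrite -es /sloped takagi_sym; ring.
have [|||v] := @IVT R (sloped k) 0 (1 - s) w.
- lra.
- apply: continuous_subspaceT => x; apply: cvgD; first exact: takagi_continuous.
  by apply: cvgM; [exact: cvg_cst|exact: cvg_id].
- by rewrite h0 h1 min_l ?max_r ?w0// (le_trans w0).
rewrite in_itv /= => /andP[v0 v1] ev; exists v => //.
by rewrite v0; lra.
Qed.

(** * Renormalization and uniqueness of solutions *)

(** The index [m] stands for slope [m + 1]: for [0 <= w < m + 1], [multiple n m w] says
    that within [n] renormalization steps the equation [sloped m.+1 x = w] is seen to
    have a solution in each half of some dyadic interval. *)
Fixpoint multiple (R : realType) (n m : nat) (w : R) : Prop :=
  if n isn't n'.+1 then False else
    multiple n' m.+1 (2 * w) \/
    if m isn't m'.+1 then False else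
      m'.+3%:R <= 2 * w <= m'.+3%:R + peak R m'.+3 \/
      multiple n' m' (2 * w - m'.+3%:R).

(** The definition imposes no range on [w]; the range is forced because every successful chain ends
    in one of the intervals, and pulling back along either branch preserves the bounds. *)
Lemma multiple_itv (R : realType) (n m : nat) (w : R) :
  multiple n m w -> 0 <= w < m.+1%:R.
Proof.
elim: n m w => [//|n ih] [|m] w /= => [[|//]|[|[|]]].
- by move=> /ih /andP[h0 h1]; apply/andP; split; lra.
- move=> /ih /andP[h0 h1]; have := ler0n R m.
  by rewrite -[m.+3%:R]natr1 -[m.+2%:R]natr1 -[m.+1%:R]natr1 in h1 *;
    move=> ?; apply/andP; split; lra.
- move=> /andP[]; have := ler0n R m; have := peak_le R m.+3.
  by rewrite -[m.+3%:R]natr1 -[m.+2%:R]natr1 -[m.+1%:R]natr1;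
    move=> *; apply/andP; split; lra.
- move=> /ih /andP[h0 h1]; have := ler0n R m.
  by rewrite -[m.+3%:R]natr1 -[m.+2%:R]natr1 -[m.+1%:R]natr1 in h0 h1 *;
    move=> ?; apply/andP; split; lra.
Qed.

(** At the end of the chain the two solutions lie in different halves. Both are then carried back by
    u/2 or by (1 + u)/2, which are injective. *)
Lemma multiple_two (R : realType) (n m : nat) (w : R) : multiple n m w ->
  exists u v : R, [/\ 0 <= u < 1, 0 <= v < 1, u != v,
    sloped m.+1 u = w & sloped m.+1 v = w].
Proof.
have left k (u x : R) : 0 <= u < 1 -> sloped k.+1 u = 2 * x ->
    0 <= u / 2 < 1 / 2 /\ sloped k (u / 2) = x.
  move=> /andP[u0 u1] e; split; first by apply/andP; split; lra.
  rewrite sloped_left; last by apply/andP; split; lra.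
  by rewrite (_ : 2 * (u / 2) = u) ?e; [|field]; lra.
have right k (u x : R) : 0 <= u < 1 -> sloped k u = 2 * x - k.+2%:R ->
    1 / 2 <= (1 + u) / 2 < 1 /\ sloped k.+1 ((1 + u) / 2) = x.
  move=> /andP[u0 u1] e; split; first by apply/andP; split; lra.
  rewrite sloped_right; last by apply/andP; split; lra.
  by rewrite (_ : 2 * ((1 + u) / 2) - 1 = u) ?e; [|field]; lra.
elim: n m w => [//|n ih] m w /= [/ih|].
  move=> [u [v [hu hv uv eu ev]]].
  have [/andP[? ?] eu'] := left _ _ _ hu eu.
  have [/andP[? ?] ev'] := left _ _ _ hv ev.
  exists (u / 2), (v / 2); split=> //; try by apply/andP; split; lra.
  by apply: contra uv => /eqP e; apply/eqP; lra.
case: m => [//|m] [/andP[h0 h1]|/ih].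
  have [|u hu eu] := @sloped_surj R m.+3 (2 * w).
    by rewrite h1 andbT; have := ler0n R m.+3; lra.
  have [|v hv ev] := @sloped_surj R m.+1 (2 * w - m.+3%:R).
    have := ler0n R m.+1; have := peak_gt0 R m.+2; have := peak_gt0 R m.+1.
    by rewrite !(peakS R m.+2) !(peakS R m.+1) in h1 *; move=> *; apply/andP; split; lra.
  have [/andP[? ?] eu'] := left _ _ _ hu eu.
  have [/andP[? ?] ev'] := right _ _ _ hv ev.
  exists (u / 2), ((1 + v) / 2); split=> //; try by apply/andP; split; lra.
  by apply/eqP; lra.
move=> [u [v [hu hv uv eu ev]]].
have [/andP[? ?] eu'] := right _ _ _ hu eu.
have [/andP[? ?] ev'] := right _ _ _ hv ev.
exists ((1 + u) / 2), ((1 + v) / 2); split=> //; try by apply/andP; split; lra.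
by apply: contra uv => /eqP e; apply/eqP; lra.
Qed.

(** Two solutions always fall in the same half, so doubling carries them to two solutions of the
    next equation at twice the distance. After N steps that distance is still at most 1, whence |u -
    v| <= 2^-N. *)
Lemma not_multiple_unique (R : realType) (m : nat) (w u v : R) :
  w < m.+1%:R -> (forall n, ~ multiple n m w) -> 0 <= u < 1 -> 0 <= v < 1 ->
  sloped m.+1 u = w -> sloped m.+1 v = w -> u = v.
Proof.
have half N : forall m (w u v : R), w < m.+1%:R -> (forall n, ~ multiple n m w) ->
    0 <= u < 1 -> 0 <= v < 1 ->
    sloped m.+1 u = w -> sloped m.+1 v = w -> `|u - v| <= 0 + 1 * (1 / 2) ^+ N.
  elim: N => [|N ih] {}m {}w {}u {}v wm hw hu hv eu ev.
    rewrite expr0 ler_norml; move: hu hv => /andP[? ?] /andP[? ?].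
    by apply/andP; split; lra.
  have double u' v' : `|u' - v'| <= 0 + 1 * (1 / 2) ^+ N -> u' - v' = 2 * (u - v) ->
      `|u - v| <= 0 + 1 * (1 / 2) ^+ N.+1.
    by move=> h e; move: h; rewrite e normrM (ger0_norm (_ : 0 <= 2 :> R))// exprS; lra.
  have geq x : 0 <= x < 1 -> sloped m.+1 x = w -> 1 / 2 <= x -> m.+2%:R <= 2 * w.
    move=> /andP[x0 x1] e xh; move: e; rewrite sloped_right; last by rewrite xh ltW.
    by have : 0 <= sloped m (2 * x - 1); [apply: sloped_ge0|]; lra.
  have leq x : 0 <= x < 1 -> sloped m.+1 x = w -> x <= 1 / 2 ->
      2 * w <= m.+2%:R + peak R m.+2.
    move=> /andP[x0 x1] e xh; move: e; rewrite sloped_left ?xh ?x0//.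
    have /(sloped_le m.+2) : 0 <= 2 * x <= 1 by apply/andP; split; lra.
    lra.
  have [c|c] := ltP (2 * w) m.+2%:R.
    have lt x : 0 <= x < 1 -> sloped m.+1 x = w ->
        0 <= 2 * x < 1 /\ sloped m.+2 (2 * x) = 2 * w.
      move=> hx ex; have [h|h] := ltP x (1 / 2); last by have := geq x hx ex h; lra.
      move/andP: hx => [x0 x1]; split; first by apply/andP; split; lra.
      by move: ex; rewrite sloped_left; [lra|rewrite x0 ltW].
    have [hu' eu'] := lt _ hu eu; have [hv' ev'] := lt _ hv ev.
    apply: (double (2 * u) (2 * v)); last by ring.
    by apply: (ih m.+1 (2 * w)) => // n h; apply: (hw n.+1); left.
  (* At slope 1 the condition w < 1 gives 2w < 2, so the right half is never entered. At larger
     slopes the failure of the interval condition pushes 2w above the range of the left half. *)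
  case: m => [|m] in wm hw eu ev geq leq c *; first by lra.
  have c' : m.+3%:R + peak R m.+3 < 2 * w.
    rewrite ltNge; apply/negP => h; apply: (hw 1%N); right; left.
    by rewrite c.
  have gt x : 0 <= x < 1 -> sloped m.+2 x = w ->
      0 <= 2 * x - 1 < 1 /\ sloped m.+1 (2 * x - 1) = 2 * w - m.+3%:R.
    move=> hx ex; have [h|h] := leP x (1 / 2); first by have := leq x hx ex h; lra.
    move/andP: hx => [x0 x1]; split; first by apply/andP; split; lra.
    by move: ex; rewrite sloped_right; [lra|rewrite !ltW].
  have [hu' eu'] := gt _ hu eu; have [hv' ev'] := gt _ hv ev.
  apply: (double (2 * u - 1) (2 * v - 1)); last by ring.
  apply: (ih m (2 * w - m.+3%:R)) => //.
    by move: wm; rewrite -[m.+3%:R]natr1 -[m.+2%:R]natr1 -[m.+1%:R]natr1; lra.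
  by move=> n h; apply: (hw n.+1); right; right.
move=> wm hw hu hv eu ev; apply/eqP; rewrite -subr_eq0 -normr_le0.
apply: (@le_geometric _ _ _ 1 (1 / 2)); first by rewrite ger0_norm; lra.
by move=> N; apply: (half N m w).
Qed.

(** * [S2] in terms of renormalization *)

Lemma card_set2_I2 (T : choiceType) (a b : T) : a != b ->
  ([set a; b] #= `I_2)%card.
Proof.
move=> ab; apply/card_set_bijP; exists (fun x => nat_of_bool (x != a)); split.
- by move=> x _ /=; case: (x != a).
- move=> x y; rewrite !inE => -[]-> [->|->]; rewrite ?eqxx //.
    by rewrite eq_sym ab.
  by rewrite eq_sym ab.
- move=> [|[|//]] _ /=; first by exists a; [left|rewrite eqxx].
  by exists b; [right|rewrite eq_sym ab].
Qed.

Lemma card_I2_no3 (T : choiceType) (A : set T) (a b c : T) :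
  (A #= `I_2)%card -> A a -> A b -> A c -> [|| a == b, a == c | b == c].
Proof.
move=> /card_set_bijP[f [fA finj _]] Aa Ab Ac.
have eq x y : A x -> A y -> f x = f y -> x == y.
  by move=> Ax Ay e; apply/eqP/finj; rewrite ?inE.
have := fA a Aa; have := fA b Ab; have := fA c Ac; rewrite /= .
have := eq a b Aa Ab; have := eq a c Aa Ac; have := eq b c Ab Ac.
case: (f a) => [|[|//]]; case: (f b) => [|[|//]]; case: (f c) => [|[|//]] h1 h2 h3 _ _ _;
  by [rewrite h1 ?orbT | rewrite h2 ?orbT | rewrite h3 ?orbT].
Qed.

(** On the left half T(x) = y amounts to [sloped 1 (2 * x) = 2 * y], and x -> 1 - x gives the
    solutions on the right half. Hence two solutions in all means one on the left. *)
Lemma S2_multiple (R : realType) :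
  S2 R = [set y | 0 <= y < 1 / 2 /\ forall n, ~ multiple n 0 (2 * y)].
Proof.
have lvl (u y : R) : 0 <= u < 1 -> sloped 1 u = 2 * y -> takagi_level y (u / 2).
  move=> /andP[u0 u1] e; split; first by rewrite in_itv/=; apply/andP; split; lra.
  rewrite takagi_left; last by apply/andP; split; lra.
  rewrite (_ : 2 * (u / 2) = u); last by field.
  by move: e; rewrite /sloped; lra.
have sym (x y : R) : takagi_level y x -> takagi_level y (1 - x).
  rewrite /takagi_level /= !in_itv /= takagi_sym => -[/andP[x0 x1] ->].
  by split=> //; apply/andP; split; lra.
apply/seteqP; split => y /=.
- move=> [+ card]; rewrite in_itv /= => /andP[y0 y23].
  have [yh|yh] := ltP y (1 / 2); last first.
    exfalso.
    (* For y >= 1/2 use the middle of the graph: T((1 + v)/4) = T((2 - v)/4) = 1/2 + T(v)/4. These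
       points and 1 - (1 + v)/4 are three solutions as soon as v differs from 1/2; since T(1/4) =
       T(1/2) = 1/2, the value v = 1/2 can be replaced by 1/4. *)
    have [v [/andP[v0 v1] vh ev]] : exists v : R,
        [/\ 0 <= v < 1, v != 1 / 2 & takagi v = 4 * y - 2].
      have [|v hv ev] := @sloped_surj R 0 (4 * y - 2).
        by rewrite /peak expr0 invr1 mulr1; apply/andP; split; lra.
      rewrite /sloped mul0r addr0 in ev.
      have [vh|vh] := eqVneq v (1 / 2); last by exists v.
      have t1 : takagi (1 : R) = 0 by rewrite -(takagi0 R) -[RHS]takagi_sym subr0.
      have t2 : takagi (1 / 2 : R) = 1 / 2 + takagi 1 / 2.
        rewrite takagi_left; last by apply/andP; split; lra.
        by congr (_ + takagi _ / 2); lra.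
      have t4 : takagi (1 / 4 : R) = 1 / 4 + takagi (1 / 2) / 2.
        rewrite takagi_left; last by apply/andP; split; lra.
        by congr (_ + takagi _ / 2); lra.
      exists (1 / 4); split; first by apply/andP; split; lra.
        by apply/eqP; lra.
      by rewrite -ev vh t4 t2 t1; lra.
    have l1 : takagi_level y ((1 + v) / 4).
      split; first by rewrite in_itv/=; apply/andP; split; lra.
      rewrite takagi_left; last by apply/andP; split; lra.
      rewrite (_ : 2 * ((1 + v) / 4) = (1 + v) / 2); last by lra.
      rewrite takagi_right; last by apply/andP; split; lra.
      rewrite (_ : 2 * ((1 + v) / 2) - 1 = v); last by lra.
      lra.
    have l2 : takagi_level y ((2 - v) / 4).
      split; first by rewrite in_itv/=; apply/andP; split; lra.
      rewrite takagi_left; last by apply/andP; split; lra.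
      rewrite (_ : 2 * ((2 - v) / 4) = (2 - v) / 2); last by lra.
      rewrite takagi_right; last by apply/andP; split; lra.
      rewrite (_ : 2 * ((2 - v) / 2) - 1 = 1 - v); last by lra.
      rewrite takagi_sym; lra.
    have l3 := sym _ _ l1.
    move/negP: vh; apply; have := card_I2_no3 card l1 l2 l3.
    by case/or3P => /eqP e; apply/eqP; lra.
  split; first by rewrite y0.
  move=> n /multiple_two[u [v [hu hv uv eu ev]]].
  have lu := lvl _ _ hu eu; have lv := lvl _ _ hv ev.
  move/negP: uv; apply; move/andP: hu => [u0 u1]; move/andP: hv => [v0 v1].
  by case/or3P: (card_I2_no3 card lu lv (sym _ _ lu)) => /eqP e; apply/eqP; lra.
- move=> [/andP[y0 yh] hy].
  split; first by rewrite in_itv/= y0 /=; lra.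
  have [|u hu eu] := @sloped_surj R 1 (2 * y).
    by have := peak_gt0 R 1; move=> ?; apply/andP; split; lra.
  have uni v : 0 <= v < 1 -> sloped 1 v = 2 * y -> v = u.
    by move=> hv ev; apply: (@not_multiple_unique R 0 (2 * y)) => //; lra.
  have lu := lvl _ _ hu eu.
  have [u0 u1] := andP hu.
  have uni2 x : takagi_level y x -> x < 1 / 2 -> x = u / 2.
    move=> [+ e] xh; rewrite in_itv /= => /andP[x0 x1].
    rewrite -(uni (2 * x)); [by field|by apply/andP; split; lra|].
    move: e; rewrite /sloped takagi_left; first by lra.
    by rewrite x0 ltW.
  rewrite (_ : takagi_level y = [set u / 2; 1 - u / 2]).
    by apply: card_set2_I2; apply/eqP; lra.
  apply/seteqP; split => x /=; last by case=> ->//; exact: sym.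
  move=> lx; have [h|h|h] := ltrgtP x (1 / 2).
  + by left; exact: uni2.
  + by right; have := uni2 _ (sym _ _ lx); lra.
  (* The midpoint, which is its own mirror image, is excluded by T(1/2) >= 1/2 > y. *)
  + have := lx.2; rewrite h -[1 / 2]/(1 / 2 : R) takagi_left; last by apply/andP; split; lra.
    by have := takagi_ge0 (2 * (1 / 2) : R); lra.
Qed.

(** * The G-delta property *)

Lemma continuous_affine (R : realType) (a b : R) : continuous (fun x : R => a * x + b).
Proof.
move=> x; apply: cvgD; last exact: cvg_cst.
by apply: cvgM; [exact: cvg_cst|exact: cvg_id].
Qed.

Lemma closed_multiple (R : realType) (n m : nat) : closed [set w : R | multiple n m w].
Proof.
have pre (a b : R) (A : set R) : closed A -> closed [set w | A (a * w + b)].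
  by move=> cA; apply: (continuous_closedP _).1 cA; exact: continuous_affine.
elim: n m => [|n ih] m; first exact: closed0.
have left : closed [set w : R | multiple n m.+1 (2 * w)].
  by under eq_set do rewrite -[2 * _]addr0; exact: (pre _ _ _ (ih m.+1)).
case: m left => [|m] left.
  by rewrite (_ : [set _ | _] = [set w : R | multiple n 1 (2 * w)])//;
    apply/seteqP; split => w /=; [case|move=> ?; left].
apply: (@closedU _ _ ([set w : R | _ \/ _])) => //.
apply: (@closedU _ [set w : R | m.+3%:R <= 2 * w <= m.+3%:R + peak R m.+3]).
  under eq_set do rewrite -[2 * _]addr0.
  apply: (pre _ _ [set x | m.+3%:R <= x <= m.+3%:R + peak R m.+3]).
  by rewrite -set_itvcc; exact: itv_closed.
exact: (pre _ _ _ (ih m)).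
Qed.

Lemma multipleS (R : realType) (n m : nat) (w : R) : multiple n m w -> multiple n.+1 m w.
Proof.
elim: n m w => [//|n ih] m w; rewrite -[multiple n.+2 m w]/(_ \/ _) => -[h|h].
  by left; exact: ih.
right; case: m h => [//|m] [h|h]; first by left.
by right; exact: ih.
Qed.

Lemma Gdelta_S2 (R : realType) : Gdelta (S2 R).
Proof.
(* The condition y >= 0 is not open, so it is obtained as the intersection of the conditions y >
   -1/(n+1). *)
exists (fun n : nat => `]- n.+1%:R^-1, 1 / 2[ `&` ~` [set y | multiple n 0 (2 * y)]).
  move=> n; apply: openI; first exact: itv_open.
  rewrite openC (_ : [set _ | _] = (fun y : R => 2 * y + 0) @^-1` [set w | multiple n 0 w]).
    apply: (continuous_closedP _).1; [exact: continuous_affine|exact: closed_multiple].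
  by apply/seteqP; split => y /=; rewrite addr0.
rewrite S2_multiple; apply/seteqP; split => y /=.
  move=> [/andP[y0 y1] hy] n _; split; last exact: hy.
  by rewrite /= in_itv /= y1 andbT (lt_le_trans _ y0)// oppr_lt0 invr_gt0.
move=> h; split; last by move=> n; case: (h n I).
have [+ _] := h 0%N I; rewrite /= in_itv /= => /andP[_ ->]; rewrite andbT.
rewrite leNgt; apply/negP => y0; pose n := Num.truncn (- y)^-1.
have [+ _] := h n I; rewrite /= in_itv /= ltrNl => /andP[+ _].
rewrite -[- y]invrK ltf_pV2 ?posrE ?invr_gt0 ?oppr_gt0//.
by apply/negP; rewrite -leNgt ltW// truncnS_gt.
Qed.

(** * Nowhere density *)

(** Follow the orbit of [w] for [N] steps and pull back an interval found at the end. Each pullback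
    halves distances while the weight m + 2 grows at most to m + 3; the rate 3/4 works because (m +
    3)/2 <= (3/4)(m + 2). *)
Lemma multiple_dense (R : realType) (N m : nat) (w : R) : 0 <= w < m.+1%:R ->
  exists n c d, [/\ c < d, `]c, d[ `<=` [set x | multiple n m x],
    `|c - w| <= m.+2%:R * (3 / 4) ^+ N & `|d - w| <= m.+2%:R * (3 / 4) ^+ N].
Proof.
have mid k (x : R) (u := (k.+3%:R + peak R k.+3) / 2) : 0 <= x < k.+2%:R ->
  [/\ k.+3%:R / 2 < u, `]k.+3%:R / 2, u[ `<=` [set x | multiple 1 k.+1 x],
    `|k.+3%:R / 2 - x| <= k.+3%:R & `|u - x| <= k.+3%:R].
  move=> /andP[x0 x1]; have := peak_gt0 R k.+3; have := peak_le R k.+3.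
  have k0 := ler0n R k.
  rewrite /u -[k.+3%:R]natr1 -[k.+2%:R]natr1 -[k.+1%:R]natr1 in x1 *; split; first lra.
  - move=> z; rewrite /= in_itv /= => /andP[z0 z1]; right; left.
    by rewrite -[k.+3%:R]natr1 -[k.+2%:R]natr1 -[k.+1%:R]natr1; apply/andP; split; lra.
  - by rewrite ler_norml; apply/andP; split; lra.
  - by rewrite ler_norml; apply/andP; split; lra.
have geo (k l : nat) (c x : R) M : `|c - x| <= k.+2%:R * (3 / 4) ^+ M ->
   (k <= l.+1)%N -> forall s w', x = 2 * w' - s ->
   `|(c + s) / 2 - w'| <= l.+2%:R * (3 / 4) ^+ M.+1.
  move=> h kl s w' e; have -> : (c + s) / 2 - w' = (c - x) / 2 by rewrite e; field.
  rewrite normrM (ger0_norm (_ : 0 <= 2^-1 :> R)) ?invr_ge0//.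
  have : k.+2%:R <= l.+3%:R :> R by rewrite ler_nat.
  have : 0 <= (3 / 4) ^+ M :> R by rewrite exprn_ge0//; lra.
  rewrite exprS; move: ((3 / 4) ^+ M) h => z h z0 kl'.
  have : k.+2%:R * z <= l.+3%:R * z by rewrite ler_wpM2r.
  have : 0 <= l%:R * z by rewrite mulr_ge0.
  have -> : l.+3%:R * z = l%:R * z + 3 * z by rewrite -addn3 natrD mulrDl.
  have -> : l.+2%:R * (3 / 4 * z) = 3 / 4 * (l%:R * z) + 3 / 2 * z by rewrite -addn2 natrD; field.
  by move: (l%:R * z) => lz; lra.
elim: N m w => [|N ih] m w hw.
  (* Slope 1 has no interval of its own, so the one of slope 2 is pulled back once. *)
  rewrite expr0 mulr1; case: m hw => [/andP[w0 w1]|m /mid[? ? ? ?]]; last first.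
    by exists 1%N, (m.+3%:R / 2), ((m.+3%:R + peak R m.+3) / 2).
  have [|cd sub] := mid 0%N (2 * w); first by apply/andP; split; lra.
  rewrite !ler_norml => /andP[c0 c1] /andP[d0 d1].
  exists 2%N, (3%:R / 2 / 2), ((3%:R + peak R 3) / 2 / 2); split.
  - lra.
  - move=> x; rewrite /= in_itv /= => /andP[x0 x1]; left; apply: sub.
    by rewrite /= in_itv /=; apply/andP; split; lra.
  - by rewrite ler_norml; apply/andP; split; lra.
  - by rewrite ler_norml; apply/andP; split; lra.
have [h|h] := ltP (2 * w) m.+2%:R.
  have [|n [c [d [cd sub hc hd]]]] := ih m.+1 (2 * w).
    by case/andP: hw => w0 _; rewrite h andbT; lra.
  exists n.+1, ((c + 0) / 2), ((d + 0) / 2); split.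
  - lra.
  - move=> x; rewrite /= in_itv /= => /andP[x0 x1]; left; apply: sub.
    by rewrite /= in_itv /=; apply/andP; split; lra.
  - by apply: geo hc _ _ _ _ => //; rewrite subr0.
  - by apply: geo hd _ _ _ _ => //; rewrite subr0.
case: m hw h => [|m] /andP[w0 w1] h; first by lra.
have [|n [c [d [cd sub hc hd]]]] := ih m (2 * w - m.+3%:R).
  by move: w1; rewrite -[m.+3%:R]natr1 -[m.+2%:R]natr1 in h *; move=> ?; apply/andP; split; lra.
exists n.+1, ((c + m.+3%:R) / 2), ((d + m.+3%:R) / 2); split.
- lra.
- move=> x; rewrite /= in_itv /= => /andP[x0 x1]; right; right; apply: sub.
  by rewrite /= in_itv /=; apply/andP; split; lra.
- by apply: geo hc _ _ _ _ => //; rewrite ltnW.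
- by apply: geo hd _ _ _ _ => //; rewrite ltnW.
Qed.

Lemma nowhere_dense_S2 (R : realType) : nowhere_dense (S2 R).
Proof.
apply/seteqP; split => // x /nbhs_ballP[e /= e0 sub].
have e2 : 0 < e / 2 by lra.
have [z [S2z]] : S2 R `&` ball x (e / 2) !=set0.
  by apply: sub (ballxx x e0) _ _; exact: nbhsx_ballx.
rewrite /ball /= => xz; move: (S2z); rewrite S2_multiple => -[/andP[z0 z1] _].
have [N hN] : exists N, (3 / 4) ^+ N <= e / 4.
  by apply: expr_le_exists; [rewrite ger0_norm; lra|lra].
have [|n [c [d [cd csub]]]] := @multiple_dense R N 0 (2 * z).
  by apply/andP; split; lra.
rewrite !ler_norml => /andP[c0 c1] /andP[d0 d1].
move: xz; rewrite ltr_norml => /andP[xz0 xz1].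
(* The halved endpoints are within e/4 of z, and z is within e/2 of x, so the midpoint of ]c/2, d/2[
   stays in the ball. *)
have xcd : ball x e ((c + d) / 4).
  by rewrite /ball /= ltr_norml; apply/andP; split; lra.
have [p [S2p]] : S2 R `&` [set` `]c / 2, d / 2[] !=set0.
  apply: sub xcd _ _.
  by apply: open_nbhs_nbhs; split; [exact: itv_open|rewrite /= in_itv /=; apply/andP; split; lra].
rewrite /= in_itv /= => /andP[p0 p1].
move: S2p; rewrite S2_multiple => -[_ /(_ n)]; apply.
by apply: csub; rewrite /= in_itv /=; apply/andP; split; lra.
Qed.

(** * Failure of closedness *)

(** The orbit of 11/15 is periodic: 11/15, 22/15, 44/15, 28/15 at slopes 1, 2, 3, 2. *)
Lemma not_multiple_11_15 (R : realType) (n : nat) : ~ multiple n 0 (11 / 15 : R).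
Proof.
have h : [/\ ~ multiple n 0 (11 / 15 : R), ~ multiple n 1 (22 / 15 : R),
    ~ multiple n 2 (44 / 15 : R) & ~ multiple n 1 (28 / 15 : R)].
  elim: n => [|n [h0 h1 h2 h3]]; first by split.
  have p3 : peak R 3 = 1 / 12 by rewrite /peak; field.
  have p4 : peak R 4 = 1 / 24 by rewrite /peak; field.
  split=> /=.
  - by case=> // h; apply: h1; rewrite (_ : 22 / 15 = 2 * (11 / 15)) //; lra.
  - rewrite p3 => -[|[/andP[]|/multiple_itv/andP[]]]; try lra.
    by move=> h; apply: h2; rewrite (_ : 44 / 15 = 2 * (22 / 15)) //; lra.
  - rewrite p4 => -[/multiple_itv/andP[]|[/andP[]|]]; try lra.
    by move=> h; apply: h3; rewrite (_ : 28 / 15 = 2 * (44 / 15) - 4) //; lra.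
  - rewrite p3 => -[/multiple_itv/andP[]|[/andP[]|]]; try lra.
    by move=> h; apply: h0; rewrite (_ : 11 / 15 = 2 * (28 / 15) - 3) //; lra.
by case: h.
Qed.

(** Near the right endpoint w = 1 two steps, left and then right, return to slope 1 with 1 - e
    replaced by 1 - 4e. The bound 11/48 is the condition 4 - 4e > 3 + 1/12, which keeps the orbit
    above the interval of slope 2. *)
Lemma not_multiple_near1 (R : realType) (e : R) : 0 < e < 11 / 48 ->
  (forall n, ~ multiple n 0 (1 - 4 * e)) -> forall n, ~ multiple n 0 (1 - e).
Proof.
move=> /andP[e0 e1] h n; case: n => [//|n] /= [|//]; case: n => [//|n] /=.
rewrite (_ : peak R 3 = 1 / 12); last by rewrite /peak; field.
case=> [/multiple_itv/andP[_]|[/andP[]|/=]]; [lra|lra|].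
by rewrite (_ : 2 * (2 * (1 - e)) - 3 = 1 - 4 * e); [exact: h|lra].
Qed.

Lemma not_closed_S2 (R : realType) : ~ closed (S2 R).
Proof.
(* Chosen so that 2 y_0 = 11/15 and the distance of 2 y_j from 1 is divided by 4 at each step; the
   limit 1/2 lies outside [S2]. *)
move=> cl; pose y (j : nat) : R := 1 / 2 - 2 / 15 * (1 / 4) ^+ j.
have pow j : 0 < (1 / 4 : R) ^+ j <= 1.
  by rewrite exprn_gt0 ?exprn_ile1//; lra.
have hy j : forall n, ~ multiple n 0 (2 * y j).
  elim: j => [|j ih].
    rewrite (_ : 2 * y 0%N = 11 / 15); last by rewrite /y expr0; lra.
    exact: not_multiple_11_15.
  have /andP[p0 p1] := pow j.
  rewrite (_ : 2 * y j.+1 = 1 - 1 / 15 * (1 / 4) ^+ j); last by rewrite /y exprS; field.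
  apply: not_multiple_near1; first by apply/andP; split; lra.
  by rewrite (_ : 1 - 4 * _ = 2 * y j)// /y; lra.
have S2y j : S2 R (y j).
  rewrite S2_multiple; split; last exact: hy.
  by have /andP[p0 p1] := pow j; rewrite /y; apply/andP; split; lra.
have cy : y j @[j --> \oo] --> (1 / 2 - 2 / 15 * 0 : R).
  apply: cvgB; first exact: cvg_cst.
  apply: cvgM; first exact: cvg_cst.
  by apply: cvg_expr; rewrite ger0_norm; lra.
have := closed_cvg _ cl (nearW _ S2y) _ cy.
by rewrite S2_multiple => -[/andP[_]]; lra.
Qed.

(** * Lower bound for the measure *)

(** The affine copy with origin [a] and scale [r]. Both branches of the recursion yield copies of
    the same kind, so the measure estimates go by induction over all [a] and [r] without a change of
    variables. *)
Definition scaled_multiple (R : realType) (n m : nat) (a r : R) : set R :=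
  [set y | multiple n m ((y - a) / r)].

Lemma measurable_scaled_multiple (R : realType) (n m : nat) (a r : R) :
  measurable (scaled_multiple n m a r).
Proof.
apply: closed_measurable.
rewrite (_ : scaled_multiple _ _ _ _ =
    (fun y => r^-1 * y + - (a / r)) @^-1` [set w | multiple n m w]).
  apply: (continuous_closedP _).1; [exact: continuous_affine|exact: closed_multiple].
by apply/funext => y; rewrite /scaled_multiple /= mulrBl [r^-1 * y]mulrC.
Qed.

Lemma lebesgue_measure_le3 (R : realType) (A B C D : set R) :
  measurable A -> measurable B -> measurable C -> measurable D ->
  A `<=` B `|` C `|` D ->
  (lebesgue_measure A <= lebesgue_measure B + lebesgue_measure C + lebesgue_measure D)%E.
Proof.
move=> mA mB mC mD sub.
have mBC : measurable (B `|` C) by exact: measurableU.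
apply: (@le_trans _ _ (lebesgue_measure (B `|` C `|` D))).
  by apply: le_measure; rewrite ?inE//; exact: measurableU.
apply: le_trans (measureU2 lebesgue_measure mBC mD) _; apply: leeD => //.
exact: measureU2.
Qed.

Lemma lebesgue_measure_itvcc (R : realType) (a b : R) : a <= b ->
  lebesgue_measure (`[a, b]%classic : set R) = (b - a)%:E.
Proof.
move=> ab; rewrite lebesgue_measure_itv /= lte_fin.
case: ltP => [_|ba]; first by rewrite EFinB.
by rewrite (_ : a = b) ?subrr//; apply/eqP; rewrite eq_le ab ba.
Qed.

Lemma scaled_multipleS (R : realType) (n m : nat) (a r : R) : 0 < r ->
  scaled_multiple n.+1 m.+1 a r = scaled_multiple n m.+2 a (r / 2) `|`
    `[a + r * m.+3%:R / 2, a + r * (m.+3%:R + peak R m.+3) / 2] `|`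
    scaled_multiple n m (a + r * m.+3%:R / 2) (r / 2).
Proof.
move=> r0; have rn : r != 0 by rewrite gt_eqF.
apply/funext => y; apply/propext.
have e1 : (y - a) / (r / 2) = 2 * ((y - a) / r) by field.
have e2 : (y - (a + r * m.+3%:R / 2)) / (r / 2) = 2 * ((y - a) / r) - m.+3%:R.
  by field.
rewrite /scaled_multiple /setU /= in_itv /= e1 e2.
have -> : (a + r * m.+3%:R / 2 <= y <= a + r * (m.+3%:R + peak R m.+3) / 2) =
    (m.+3%:R <= 2 * ((y - a) / r) <= m.+3%:R + peak R m.+3).
  rewrite -[y in LHS](_ : a + r * ((y - a) / r) = y); last by field.
  by rewrite !lerD2l -!mulrA !ler_pM2l// ler_pdivrMr// ler_pdivlMr// ![_ * 2]mulrC.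
tauto.
Qed.

Lemma scaled_multiple0 (R : realType) (n : nat) (a r : R) : 0 < r ->
  scaled_multiple n.+1 0 a r = scaled_multiple n 1 a (r / 2).
Proof.
move=> r0; have rn : r != 0 by rewrite gt_eqF.
apply/funext => y; rewrite /scaled_multiple /=.
rewrite (_ : (y - a) / (r / 2) = 2 * ((y - a) / r)); last by field.
by apply/propext; tauto.
Qed.

(** The bound [b_k = 1/2 - e_k] solves [2 b_k = b_(k+1) + e_(k+1) + b_(k-1)] with
    [b_2 = 2 b_1], so it dominates the sum of the lengths of all removed intervals. *)
Lemma lebesgue_scaled_multiple_le (R : realType) (n m : nat) (a r : R) : 0 < r ->
  (lebesgue_measure (scaled_multiple n m a r) <= (r * (1 / 2 - peak R m.+1))%:E)%E.
Proof.
elim: n m a r => [|n ih] m a r r0.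
  rewrite (_ : scaled_multiple _ _ _ _ = set0)// measure0 lee_fin mulr_ge0//; first exact: ltW.
  by have := peak_le R m; rewrite peakS; lra.
have r2 : 0 < r / 2 by lra.
case: m => [|m].
  rewrite scaled_multiple0//; apply: le_trans (ih _ _ _ r2) _.
  by rewrite lee_fin !peakS /peak expr0; lra.
rewrite scaled_multipleS//; set L := scaled_multiple n m.+2 _ _.
set I := [set` _]; set U := scaled_multiple n m _ _.
have mL : measurable L by exact: measurable_scaled_multiple.
have mU : measurable U by exact: measurable_scaled_multiple.
have mI : measurable I by exact: measurable_itv.
have hLIU : (lebesgue_measure (L `|` I `|` U) <=
    lebesgue_measure L + lebesgue_measure I + lebesgue_measure U)%E.
  by apply: lebesgue_measure_le3 => //; do 2 apply: measurableU => //.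
apply: le_trans hLIU _.
apply: le_trans (leeD (leeD (ih _ _ _ r2) (lexx _)) (ih _ _ _ r2)) _.
have p0 := mulr_gt0 r0 (peak_gt0 R m.+3).
rewrite /I lebesgue_measure_itvcc; last by lra.
by rewrite -!EFinD lee_fin (peakS R m.+2) (peakS R m.+1); lra.
Qed.

(** The [j]-fold leftmost descendant carries at most [b_(m+1+j) / 2^j] of the bound and
    lives in [[0, (m + 1 + j) / 2^j)]; discarding that interval saves its share. *)
Lemma lebesgue_scaled_multiple_away_le (R : realType) (n m j : nat) (a r : R) : 0 < r ->
  (lebesgue_measure (scaled_multiple n m a r `&`
     [set` `]a + r * ((m.+1 + j)%:R * 2 ^- j), +oo[%R]) <=
   (r * (1 / 2 - peak R m.+1 - (1 / 2 - peak R (m.+1 + j)) * 2 ^- j))%:E)%E.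
Proof.
elim: j n m a r => [|j ih] n m a r r0.
  rewrite addn0 expr0 invr1 !mulr1 subrr mulr0.
  rewrite (_ : _ `&` _ = set0) ?measure0//.
  apply/seteqP; split => // y [/multiple_itv/andP[_]].
  by rewrite ltr_pdivrMr// /= in_itv /= andbT; lra.
(* For n = 0 the set is empty, and the nonnegativity of the bound is read off from the case n =
   1. *)
wlog [n' en] : n / exists n', n = n'.+1.
  move=> hS; case: n => [|n]; last by apply: hS; exists n.
  rewrite (_ : _ `&` _ = set0) ?measure0; last by apply/seteqP; split => // y [].
  by apply: le_trans (measure_ge0 _ _) (hS 1%N _); exists 0%N.
rewrite {}en {n}; move: n' => n.
have r2 : 0 < r / 2 by lra.
set C := [set` _].
(* The cut point is the same for the left child: its scale is halved and its slope is one larger. *)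
have eC : C = [set` `]a + r / 2 * ((m.+2 + j)%:R * 2 ^- j), +oo[].
  rewrite /C (_ : r * _ = r / 2 * ((m.+2 + j)%:R * 2 ^- j))//.
  by rewrite addnS -addSn exprS invfM; field; rewrite expf_neq0.
have mC : measurable C by exact: measurable_itv.
have eb : 1 / 2 - peak R m.+1 - (1 / 2 - peak R (m.+1 + j.+1)) * 2 ^- j.+1 =
  1 / 2 - peak R m.+1 - (1 / 2 - peak R (m.+2 + j)) * 2 ^- j / 2.
  by rewrite addnS -addSn exprS invfM; ring.
rewrite {}eb; have := ih n m.+1 a _ r2; rewrite -eC {eC}.
move: ((_ - peak R (m.+2 + j)) * _) => z; case: m C mC => [|m] C mC hL.
  rewrite scaled_multiple0//; apply: le_trans hL _.
  by rewrite lee_fin !peakS /peak expr0; lra.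
rewrite scaled_multipleS//; move: hL; set L := scaled_multiple n m.+2 _ _ => hL.
set I := [set` _]; set U := scaled_multiple n m _ _.
have mL : measurable L by exact: measurable_scaled_multiple.
have mU : measurable U by exact: measurable_scaled_multiple.
have mI : measurable I by exact: measurable_itv.
have hLIU : (lebesgue_measure ((L `|` I `|` U) `&` C) <=
    lebesgue_measure (L `&` C) + lebesgue_measure I + lebesgue_measure U)%E.
  apply: lebesgue_measure_le3 => //.
  - by apply: measurableI => //; do 2 apply: measurableU => //.
  - exact: measurableI.
  - by move=> y [[[|]|] ? ?]; [left; left|left; right|right].
apply: le_trans hLIU _.
apply: le_trans (leeD (leeD hL (lexx _)) (lebesgue_scaled_multiple_le _ _ _ r2)) _.
have p0 := mulr_gt0 r0 (peak_gt0 R m.+3).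
rewrite /I lebesgue_measure_itvcc; last by lra.
by rewrite -!EFinD lee_fin (peakS R m.+2) (peakS R m.+1); lra.
Qed.

(** The general estimate gives b_1/2 = 1/12. The saving must be uniform in [n] to survive the limit;
    it equals b_8 / 1024, which exceeds 1/4096. *)
Lemma lebesgue_multiple_le (R : realType) (n : nat) :
  (lebesgue_measure [set y : R | multiple n 0 (2 * y)] <= (1 / 12 - 1 / 4096)%:E)%E.
Proof.
have -> : [set y : R | multiple n 0 (2 * y)] = scaled_multiple n 0 0 (1 / 2).
  by apply/funext => y; rewrite /scaled_multiple /= subr0; congr (multiple _ _ _); field.
have mono k : scaled_multiple k 0 0 (1 / 2) `<=` scaled_multiple k.+1 0 0 (1 / 2 : R).
  by move=> y; exact: multipleS.
have h0 : 0 < 1 / 2 :> R by lra.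
have h1 : 0 < 1 / 2 / 2 :> R by lra.
have h2 : 0 < 1 / 2 / 2 / 2 :> R by lra.
have p3 : peak R 3 = 1 / 12 by rewrite /peak; field.
apply: (@le_trans _ _ (lebesgue_measure (scaled_multiple n.+2 0 0 (1 / 2 : R)))).
  apply: le_measure; rewrite ?inE; try exact: measurable_scaled_multiple.
  exact: subset_trans (mono _) (mono _).
rewrite scaled_multiple0// scaled_multipleS//.
set L := scaled_multiple n 2 _ _; set I := [set` _]; set U := scaled_multiple n 0 _ _.
(* The leftmost 7-fold descendant inside [U] is contained in the removed interval [I]. *)
pose V : set R := U `&` [set` `](3 / 8 : R) + 1 / 2 / 2 / 2 * ((1 + 7)%:R * 2 ^- 7), +oo[].
have mL : measurable L by exact: measurable_scaled_multiple.
have mU : measurable U by exact: measurable_scaled_multiple.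
have mI : measurable I by exact: measurable_itv.
have mV : measurable V by apply: measurableI => //; exact: measurable_itv.
have hLIV : (lebesgue_measure (L `|` I `|` U) <=
    lebesgue_measure L + lebesgue_measure I + lebesgue_measure V)%E.
  apply: lebesgue_measure_le3 => //; first by do 2 apply: measurableU => //.
  move=> y [?|Uy]; first by left.
  (* Here [I] is [3/8, 37/96] and 49/128 = 3/8 + (1/8)(8/128) is the cut point, below 37/96. The
     depth 7 is the least j with (1 + j)/2^j <= 1/12. *)
  have [h|h] := ltP (49 / 128) y.
    right; split=> //; rewrite /= in_itv /= andbT; apply: le_lt_trans h.
    by rewrite -(natrX R 2 7); lra.
  left; right; move: Uy => /multiple_itv /andP[+ _].
  rewrite /I /= in_itv /= p3 pmulr_lge0 ?invr_gt0// subr_ge0 => h'.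
  by apply/andP; split; lra.
apply: le_trans hLIV _.
have hV : (lebesgue_measure V <= (1 / 2 / 2 / 2 *
    (1 / 2 - peak R 1 - (1 / 2 - peak R 8) * 2 ^- 7))%:E)%E.
  rewrite /V /U (_ : 0 + _ = 3 / 8); last by lra.
  exact: (@lebesgue_scaled_multiple_away_le R n 0 7).
apply: le_trans (leeD (leeD (lebesgue_scaled_multiple_le _ _ _ h2) (lexx _)) hV) _.
rewrite /I lebesgue_measure_itvcc; last by rewrite p3; lra.
rewrite -!EFinD lee_fin p3 /peak -(natrX R 2 1) -(natrX R 2 7) -(natrX R 2 8); lra.
Qed.

Lemma lebesgue_S2_gt (R : realType) :
  ((5 / 12)%:E < lebesgue_measure (S2 R))%E.
Proof.
have mS : measurable (S2 R) by apply: Gdelta_measurable; exact: Gdelta_S2.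
pose B (n : nat) : set R := [set y | multiple n 0 (2 * y)].
have mB n : measurable (B n).
  rewrite (_ : B n = scaled_multiple n 0 0 (1 / 2)); first exact: measurable_scaled_multiple.
  by apply/funext => y; rewrite /B /scaled_multiple /= subr0; congr (multiple _ _ _); field.
have mUB : measurable (\bigcup_n B n) by exact: bigcupT_measurable.
have leB : (lebesgue_measure (\bigcup_n B n) <= (1 / 12 - 1 / 4096)%:E)%E.
  have cB : lebesgue_measure (B n) @[n --> \oo] --> lebesgue_measure (\bigcup_n B n).
    apply: nondecreasing_cvg_mu => //; apply/nondecreasing_seqP => n.
    by apply/subsetPset => y; exact: multipleS.
  rewrite -(cvg_lim (@ereal_hausdorff R) cB); apply: lime_le.
    by apply/cvg_ex; exists (lebesgue_measure (\bigcup_n B n)).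
  by apply: nearW => n; exact: lebesgue_multiple_le.
have : (lebesgue_measure ([set` `[0, 1 / 2[%R] : set R) <=
    lebesgue_measure (S2 R) + lebesgue_measure (\bigcup_n B n))%E.
  apply: le_trans (measureU2 lebesgue_measure mS mUB).
  apply: le_measure; rewrite ?inE; [exact: measurable_itv|exact: measurableU|].
  move=> y; rewrite /= in_itv /= => hy.
  have [h|h] := pselect (exists n, B n y).
    by right; case: h => n; exists n.
  by left; rewrite S2_multiple; split => // n hn; apply: h; exists n.
rewrite lebesgue_measure_itv /= lte_fin ifT; last by lra.
move=> h; rewrite ltNge; apply/negP => hS.
have := le_trans h (leeD hS leB).
by rewrite -EFinB -EFinD lee_fin; lra.
Qed.

(** * Upper bound for the measure *)

Lemma lebesgue_S2_lt (R : realType) :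
  (lebesgue_measure (S2 R) < (35 / 72)%:E)%E.
Proof.
have mS : measurable (S2 R) by apply: Gdelta_measurable; exact: Gdelta_S2.
have p3 : peak R 3 = 1 / 12 by rewrite /peak; field.
have p4 : peak R 4 = 1 / 24 by rewrite /peak; field.
(* The gaps come from 4 <= 16y <= 4 + 1/24 (slope 3), 3 <= 8y <= 3 + 1/12 (slope 2) and 3 <= 32y -
   12 <= 3 + 1/12 (slope 2 again, after the moves left, right, left), found at stages 3, 2 and 4.
   Their lengths are 1/384, 1/96 and 1/384. *)
have sub : S2 R `<=` ([set` `[0, 1 / 4]] `|` [set` `[97 / 384, 3 / 8]]) `|`
    [set` `[37 / 96, 15 / 32]] `|` [set` `[181 / 384, 1 / 2]].
  rewrite S2_multiple => y [/andP[y0 y1] hy].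
  have [h1|h1] := leP y (1 / 4); first by left; left; left; rewrite /= in_itv /= y0 h1.
  have [h2|h2] := ltP y (97 / 384).
    case: (hy 3); left; left; right; left; rewrite p4; apply/andP; split; lra.
  have [h3|h3] := leP y (3 / 8); first by left; left; right; rewrite /= in_itv /= h2 h3.
  have [h4|h4] := ltP y (37 / 96).
    case: (hy 2); left; right; left; rewrite p3; apply/andP; split; lra.
  have [h5|h5] := leP y (15 / 32); first by left; right; rewrite /= in_itv /= h4 h5.
  have [h6|h6] := ltP y (181 / 384).
    case: (hy 4); left; right; right; left; right; left; rewrite p3; apply/andP; split; lra.
  by right; rewrite /= in_itv /= h6 ltW.
have mI (i : interval R) : measurable [set` i] by exact: measurable_itv.
apply: le_lt_trans (_ : _ <= (1 / 4 + (3 / 8 - 97 / 384) + (15 / 32 - 37 / 96) +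
    (1 / 2 - 181 / 384))%:E)%E _; last by rewrite lte_fin; lra.
have := @lebesgue_measure_le3 R _ _ _ _ mS (measurableU _ _ (mI _) (mI _)) (mI _) (mI _) sub.
move=> /le_trans; apply.
have h : (lebesgue_measure
      ([set` `[0%R, (1 / 4 : R)%R]] `|` [set` `[(97 / 384 : R)%R, (3 / 8)%R]]) <=
    lebesgue_measure [set` `[0%R, (1 / 4 : R)%R]] +
    lebesgue_measure [set` `[(97 / 384 : R)%R, (3 / 8)%R]])%E.
  exact: measureU2.
move: h; rewrite !lebesgue_measure_itvcc; [|lra..] => h.
apply: le_trans (leeD (leeD h (lexx _)) (lexx _)) _.
by rewrite -!EFinD lee_fin; lra.
Qed.

Theorem theorem4p5 (R : realType) :
  [/\ nowhere_dense (S2 R),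
      Gdelta (S2 R),
      ~ closed (S2 R),
      ((5 / 12)%:E < lebesgue_measure (S2 R))%E &
      (lebesgue_measure (S2 R) < (35 / 72)%:E)%E].
Proof.
split; [exact: nowhere_dense_S2|exact: Gdelta_S2|exact: not_closed_S2|..].
  exact: lebesgue_S2_gt.
exact: lebesgue_S2_lt.
Qed.
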